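(* Let $X$ be a Banach space, let $G$ be a semitopological semigroup, and let $\mathcal{S}=\{S_g:g\in G\}$ be a bounded representation of $G$ on $X$ such that the semigroup $\mathcal{S}$ is right amenable. Then the following assertions are equivalent (in each of (5)--(8), both the version with ''some'' and the version with ''every'' are meant, and all of these are equivalent to each other and to (1)--(4)). (1) $\mathcal{S}$ is mean ergodic with mean ergodic projection $P$. (2) $\overline{\mathrm{co}}\,\mathcal{S}x\cap\mathrm{Fix}\,\mathcal{S}\neq\emptyset$ for all $x\in X$. (3) $\mathrm{Fix}\,\mathcal{S}$ separates $\mathrm{Fix}\,\mathcal{S}'$. (4) $X=\mathrm{Fix}\,\mathcal{S}\oplus\overline{\mathrm{lin}}\,\mathrm{rg}(I-\mathcal{S})$. (5) For some/every weak right $\mathcal{S}$-ergodic net $(A_\alpha)$: $(A_\alpha x)$ has a weak cluster point in $\mathrm{Fix}\,\mathcal{S}$ for all $x\in X$. (6) For some/every weak right $\mathcal{S}$-ergodic net $(A_\alpha)$: $(A_\alpha x)$ converges weakly to a fixed point of $\mathcal{S}$ for all $x\in X$. (7) For some/every strong right $\mathcal{S}$-ergodic net $(A_\alpha)$: $(A_\alpha x)$ converges weakly to a fixed point of $\mathcal{S}$ for all $x\in X$. (8) For some/every strong right $\mathcal{S}$-ergodic net $(A_\alpha)$: $(A_\alpha x)$ converges strongly (in norm) to a fixed point of $\mathcal{S}$ for all $x\in X$. Moreover, in this case the limit $P$ of the nets $(A_\alpha)$ (in the weak operator topology for weak right $\mathcal{S}$-ergodic nets, in the strong operator topology for strong right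 $\mathcal{S}$-ergodic nets) is the mean ergodic projection of $\mathcal{S}$, and it is the projection mapping $X$ onto $\mathrm{Fix}\,\mathcal{S}$ along $\overline{\mathrm{lin}}\,\mathrm{rg}(I-\mathcal{S})$.
   Context: A semitopological semigroup is a semigroup with a topology for which multiplication is separately continuous. $\mathcal{L}(X)$ denotes the bounded linear operators on $X$, endowed with the strong operator topology. A bounded representation of $G$ on $X$ is a family $\mathcal{S}=\{S_g:g\in G\}\subset\mathcal{L}(X)$ with $\sup_{g\in G}\|S_g\|<\infty$, $S_gS_h=S_{hg}$ for all $g,h\in G$, and $g\mapsto S_gx$ (norm-)continuous for every $x\in X$. $\mathcal{S}$ is regarded as a semigroup of operators under composition with the strong operator topology. $\overline{\mathrm{co}}\,\mathcal{S}$ is the closure of the convex hull of $\mathcal{S}$ in the strong operator topology, and $\overline{\mathrm{co}}\,\mathcal{S}x$ is the norm closure of the convex hull of $\{S_gx:g\in G\}$. For a semitopological semigroup $T$, $C_b(T)$ is the space of bounded continuous functions on $T$; a mean is $m\in C_b(T)'$ with $\langle m,\mathbf{1}\rangle=\|m\|=1$. It is right invariant if $\langle m,R_tf\rangle=\langle m,f\rangle$ for all $t\in T$, $f\in C_b(T)$, where $R_tf(s)=f(st)$. $T$ is right amenable if a right invariant mean on $C_b(T)$ exists. A net $(A_\alpha)$ in $\mathcal{L}(X)$ is a strong right $\mathcal{S}$-ergodic net if $A_\alpha\in\overline{\mathrm{co}}\,\mathcal{S}$ for all $\alpha$ and $\lim_\alpha(A_\alpha x-A_\alpha S_gx)=0$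 in norm for all $x\in X$, $g\in G$; it is a weak right $\mathcal{S}$-ergodic net if the same holds with the limit in the weak topology $\sigma(X,X')$. $\mathcal{S}$ is mean ergodic if $\overline{\mathrm{co}}\,\mathcal{S}$ contains a zero element $P$, i.e. $PT=TP=P$ for all $T\in\overline{\mathrm{co}}\,\mathcal{S}$ (equivalently $PS_g=S_gP=P$ for all $g\in G$); $P$ is called the mean ergodic projection of $\mathcal{S}$. $\mathrm{Fix}\,\mathcal{S}=\{x\in X:S_gx=x\ \forall g\in G\}$; $\mathrm{Fix}\,\mathcal{S}'=\{x'\in X':S_g'x'=x'\ \forall g\in G\}$, with $S_g'$ the adjoint; $\mathrm{rg}(I-\mathcal{S})=\{x-S_gx:x\in X,g\in G\}$; $\mathrm{lin}$ is linear span and $\overline{\mathrm{lin}}$ its norm closure. ''$\mathrm{Fix}\,\mathcal{S}$ separates $\mathrm{Fix}\,\mathcal{S}'$'' means: for every $0\ne x'\in\mathrm{Fix}\,\mathcal{S}'$ there is $x\in\mathrm{Fix}\,\mathcal{S}$ with $\langle x',x\rangle\neq0$. *)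

(* Defs.v *)
From HB Require Import structures.
From mathcomp Require Import all_boot all_order all_algebra.
From mathcomp Require Import complex.
From mathcomp Require Import all_classical all_reals all_analysis.

Set Implicit Arguments.
Unset Strict Implicit.
Unset Printing Implicit Defensive.

Import Order.TTheory GRing.Theory Num.Theory.
Import numFieldNormedType.Exports.

Local Open Scope classical_set_scope.
Local Open Scope ring_scope.

(* For K = R[i], 0 <= c means that c is real and nonnegative, so that the     *)
(* norms are real and convex combinations have real coefficients.             *)
Definition real_or_complex (K : numFieldType) : Prop :=
  exists R : realType, K = R :> numFieldType \/ K = R[i]%C :> numFieldType.

Section hulls.
Context {K : numFieldType} {E : lmodType K}.

Definition convex_hull (A : set E) : set E := smallest (@convex_set K E) A.

Definition lin (A : set E) : set E :=
  [set x | exists n (c : 'I_n -> K) (a : 'I_n -> E),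
    (forall i, A (a i)) /\ x = \sum_i c i *: a i].

(* Algebraic direct sum; for closed subspaces of a Banach space it is also    *)
(* topological.                                                               *)
Definition direct_sum (U V : set E) : Prop :=
  (forall x, exists u v, [/\ U u, V v & x = u + v]) /\ U `&` V = [set 0].

End hulls.

(* The index set is a nonempty directed preorder.                             *)
Record net (T : Type) := Net {
  net_index : Type;
  net_le : net_index -> net_index -> Prop;
  net_fun :> net_index -> T;
  net_inhabited : inhabited net_index;
  net_le_refl : forall i, net_le i i;
  net_le_trans : forall i j k, net_le i j -> net_le j k -> net_le i k;
  net_directed : forall i j, exists k, net_le i k /\ net_le j k }.

Definition tails (T : Type) (A : net T) : set_system (net_index A) :=
  [set B | exists i, forall j, net_le i j -> B j].
Arguments tails {T} A _.

HB.mixin Record isSemitopological G of Topological G & Semigroup G := {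
  mulg_continuousl : forall a : G, continuous (fun x : G => (a * x)%g);
  mulg_continuousr : forall a : G, continuous (fun x : G => (x * a)%g) }.

#[short(type="semitopologicalSemigroupType")]
HB.structure Definition SemitopologicalSemigroup :=
  {G of isSemitopological G & Topological G & Semigroup G}.

Section bounded_continuous.
Context (K : numFieldType) (T : topologicalType).

Definition bounded_continuous_pred : {pred T -> K^o} :=
  [pred f | `[< continuous f /\ exists M : K, forall t, `|f t| <= M >] ].

Record bounded_continuous := BoundedContinuous {
  bc_fun :> T -> K^o;
  bc_subproof : bc_fun \in bounded_continuous_pred }.

HB.instance Definition _ := [isSub for bc_fun].
HB.instance Definition _ := [Choice of bounded_continuous by <:].

Lemma bounded_continuous_submod : submod_closed bounded_continuous_pred.
Proof.
split=> [|a f g]; rewrite !inE.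
  by split; [exact: cst_continuous|exists 0 => t; rewrite normr0].
move=> [cf [M hM]] [cg [N hN]]; split.
  by move=> t; apply: cvgD; [apply: cvgZl_tmp; exact: cf|exact: cg].
exists (`|a| * M + N) => t; apply: le_trans (ler_normD _ _) _.
by rewrite lerD// normrM ler_wpM2l.
Qed.

HB.instance Definition _ :=
  GRing.isSubmodClosed.Build K (T -> K^o) bounded_continuous_pred
    bounded_continuous_submod.
HB.instance Definition _ :=
  [SubChoice_isSubLmodule of bounded_continuous by <:].

Lemma bc_one_subproof : (fun=> 1 : K^o) \in bounded_continuous_pred.
Proof.
rewrite inE; split; first exact: cst_continuous.
by exists 1 => t; rewrite normr1.
Qed.

Definition bc_one : bounded_continuous := BoundedContinuous bc_one_subproof.

(* The supremum of |m f| over the unit ball of C_b(T) is the norm of m.       *)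
Definition is_mean (m : {linear bounded_continuous -> K^o}) : Prop :=
  m bc_one = 1 /\
  supremums
    [set `|m f| | f in [set f : bounded_continuous | forall t, `|f t| <= 1]]
    (1 : K).

End bounded_continuous.

Section amenability.
Context (K : numFieldType) (T : semitopologicalSemigroupType).

Lemma rtranslate_subproof (t : T) (f : bounded_continuous K T) :
  (fun s : T => f (s * t)%g) \in @bounded_continuous_pred K T.
Proof.
case: f => f /=; rewrite !inE => -[cf [M hM]].
split; last by exists M.
by move=> s; apply: (cvg_comp _ _ (@mulg_continuousr T t s)); exact: cf.
Qed.

Definition rtranslate (t : T) (f : bounded_continuous K T) :
  bounded_continuous K T := BoundedContinuous (rtranslate_subproof t f).

Definition right_amenable : Prop :=
  exists m : {linear bounded_continuous K T -> K^o},
    is_mean m /\ forall t f, m (rtranslate t f) = m f.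

End amenability.

Section operators.
Context {K : numFieldType}.

Section space.
Context (X Y : normedModType K).

Definition bounded_linear_pred : {pred X -> Y} :=
  [pred f | `[< linear f /\ exists M : K, forall x, `|f x| <= M * `|x| >] ].

Record bounded_op := BoundedOp {
  bop_fun :> X -> Y;
  bop_subproof : bop_fun \in bounded_linear_pred }.

HB.instance Definition _ := [isSub for bop_fun].
HB.instance Definition _ := [Choice of bounded_op by <:].

Lemma bounded_op_submod : submod_closed bounded_linear_pred.
Proof.
split=> [|a f g]; rewrite !inE.
  split; last by exists 0 => x; rewrite normr0 mul0r.
  by move=> a x y; rewrite /= scaler0 addr0.
move=> [lf [M hM]] [lg [N hN]]; split.
  move=> b x y; rewrite !fctE lf lg !scalerDr !scalerA mulrC.
  by rewrite -!addrA; congr (_ + _); rewrite addrCA.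
exists (`|a| * M + N) => x; apply: le_trans (ler_normD _ _) _.
by rewrite mulrDl lerD// normrZ -mulrA ler_wpM2l.
Qed.

HB.instance Definition _ :=
  GRing.isSubmodClosed.Build K (X -> Y) bounded_linear_pred bounded_op_submod.
HB.instance Definition _ := [SubChoice_isSubLmodule of bounded_op by <:].

Lemma bop_linear (T : bounded_op) : linear T.
Proof. by case: T => T /=; rewrite inE => -[]. Qed.

HB.instance Definition _ (T : bounded_op) :=
  GRing.isLinear.Build K X Y *:%R (bop_fun T) (bop_linear T).

Lemma bop_bounded (T : bounded_op) : exists M : K, forall x, `|T x| <= M * `|x|.
Proof. by case: T => T /=; rewrite inE => -[]. Qed.

Lemma bop_continuous (T : bounded_op) : continuous T.
Proof.
apply: bounded_linear_continuous; apply/bounded_funP => r.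
have [M hM] := bop_bounded T; exists (`|M| * r) => x xr.
apply: (@le_trans _ _ (`|M| * `|x|)); last by rewrite ler_wpM2l.
have Tx0 : 0 <= M * `|x| by apply: le_trans (hM _).
by rewrite -[in leRHS]normr_id -normrM (ger0_norm Tx0) hM.
Qed.

(* strong operator topology *)
HB.instance Definition _ :=
  Topological.copy bounded_op
    (initial_topology (bop_fun : bounded_op -> {ptws X -> Y})).

End space.

Lemma bop_comp_subproof (X Y Z : normedModType K)
    (T : bounded_op Y Z) (U : bounded_op X Y) :
  T \o U \in @bounded_linear_pred X Z.
Proof.
rewrite inE; split.
  by move=> a x y; rewrite /= !linearP.
have [[M hM] [N hN]] := (bop_bounded T, bop_bounded U).
exists (`|M| * N) => x; apply: le_trans (hM _) _; rewrite -mulrA.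
have Ux0 : 0 <= M * `|U x| by apply: le_trans (hM _).
rewrite -[leLHS]ger0_norm// normrM normr_id.
by rewrite ler_wpM2l.
Qed.

Definition bop_comp (X Y Z : normedModType K)
    (T : bounded_op Y Z) (U : bounded_op X Y) : bounded_op X Z :=
  BoundedOp (bop_comp_subproof T U).

Definition dual (X : normedModType K) := bounded_op X K^o.

Definition adjoint (X Y : normedModType K) (T : bounded_op X Y)
  (f : dual Y) : dual X := bop_comp f T.

(* X endowed with the topology sigma(X, X') *)
Definition weak (X : normedModType K) : Type := X.
HB.instance Definition _ (X : normedModType K) :=
  Topological.copy (weak X)
    (initial_topology ((fun x f => f x) : X -> {ptws dual X -> K^o})).

(* bounded operators with the weak operator topology *)
Definition wot (X : normedModType K) : Type := bounded_op X X.
HB.instance Definition _ (X : normedModType K) :=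
  Topological.copy (wot X)
    (initial_topology (@bop_fun X X : bounded_op X X -> {ptws X -> weak X})).

Section composition_semigroup.
Context (X : normedModType K).

Lemma bop_compA : associative (@bop_comp X X X).
Proof. by move=> T U V; apply: val_inj. Qed.

HB.instance Definition _ := isSemigroup.Build (bounded_op X X) bop_compA.

Lemma bop_eval_continuous (x : X) : continuous (fun T : bounded_op X X => T x).
Proof.
move=> T; apply: (continuous_comp
  (g := fun f : {ptws X -> X} => f x) (@initial_continuous _ _ _ T)).
exact: (@proj_continuous (X : eqType) (fun=> X) x).
Qed.

Lemma bop_continuous_to (U : topologicalType) (f : U -> bounded_op X X) :
  (forall x, continuous (fun u => f u x)) -> continuous f.
Proof.
move=> cf; apply: (continuous_comp_initial
  (w := @bop_fun X X : bounded_op X X -> {ptws X -> X})) => u.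
by apply/pointwise_cvgP => x; exact: cf.
Qed.

End composition_semigroup.

(* repM makes g |-> S_g an antihomomorphism, and rep_bounded says that the     *)
(* supremum over g of the operator norms is finite.                           *)
Record bounded_rep (G : semitopologicalSemigroupType) (X : normedModType K) :=
  BoundedRep {
    rep_fun :> G -> bounded_op X X;
    rep_bounded : exists M : K, forall g x, `|rep_fun g x| <= M * `|x|;
    repM : forall g h : G, (rep_fun g * rep_fun h)%g = rep_fun (h * g)%g;
    rep_continuous : forall x : X, continuous (fun g : G => rep_fun g x) }.

End operators.

Section representation.
Context {K : numFieldType} {G : semitopologicalSemigroupType}.
Context {X : normedModType K} (S : bounded_rep G X).

Definition rep_semigroup : Type := set_type (range S).

HB.instance Definition _ := Topological.on rep_semigroup.

Lemma rep_mul_subproof (a b : rep_semigroup) :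
  (val a * val b)%g \in range S.
Proof.
case: a b => [T ST] [U SU] /=; have [g _ <-] := set_mem ST.
have [h _ <-] := set_mem SU.
by apply/mem_set; exists (h * g)%g => //; rewrite repM.
Qed.

Definition rep_mul (a b : rep_semigroup) : rep_semigroup :=
  exist _ (val a * val b)%g (rep_mul_subproof a b).

Lemma rep_mulA : associative rep_mul.
Proof. by move=> a b c; apply: val_inj; rewrite /= mulgA. Qed.

HB.instance Definition _ := isSemigroup.Build rep_semigroup rep_mulA.

Lemma rep_val_continuous (x : X) :
  continuous (fun a : rep_semigroup => (val a : bounded_op X X) x).
Proof.
move=> a; apply: (continuous_comp
  (f := val : rep_semigroup -> bounded_op X X)
  (g := fun T : bounded_op X X => T x)); last exact: bop_eval_continuous.
exact: (@initial_continuous _ _ (val : rep_semigroup -> bounded_op X X)).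
Qed.

Lemma rep_continuous_to (U : topologicalType) (f : U -> rep_semigroup) :
  (forall x : X, continuous (fun u => (val (f u) : bounded_op X X) x)) ->
  continuous f.
Proof.
move=> cf; apply: (continuous_comp_initial
  (w := val : rep_semigroup -> bounded_op X X)).
exact: bop_continuous_to.
Qed.

Lemma rep_mul_continuousl (a : rep_semigroup) :
  continuous (fun b : rep_semigroup => (a * b)%g).
Proof.
apply: rep_continuous_to => x b.
apply: (continuous_comp (f := fun b : rep_semigroup => (val b : bounded_op X X) x)
  (g := (val a : bounded_op X X))); first exact: rep_val_continuous.
exact: bop_continuous.
Qed.

Lemma rep_mul_continuousr (a : rep_semigroup) :
  continuous (fun b : rep_semigroup => (b * a)%g).
Proof. by apply: rep_continuous_to => x; exact: rep_val_continuous. Qed.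

HB.instance Definition _ :=
  isSemitopological.Build rep_semigroup rep_mul_continuousl rep_mul_continuousr.

Definition fix_space : set X := [set x | forall g, S g x = x].

Definition fix_dual : set (dual X) := [set f | forall g, adjoint (S g) f = f].

Definition fix_separates : Prop :=
  forall f : dual X, fix_dual f -> f <> 0 -> exists2 x, fix_space x & f x <> 0.

Definition rg_sub : set X := [set y | exists x g, y = x - S g x].

Definition clin_rg_sub : set X := closure (lin rg_sub).

(* closure in the strong operator topology, the topology of bounded_op X X *)
Definition cco : set (bounded_op X X) := closure (convex_hull (range S)).

Definition cco_orbit (x : X) : set X :=
  closure (convex_hull (range (fun g => S g x))).

Definition mean_ergodic_projection (P : bounded_op X X) : Prop :=
  cco P /\ forall T, cco T -> (P * T)%g = P /\ (T * P)%g = P.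

Definition mean_ergodic : Prop := exists P, mean_ergodic_projection P.

Definition strong_right_ergodic (A : net (bounded_op X X)) : Prop :=
  (forall i, cco (A i)) /\
  forall x g, A i x - A i (S g x) @[i --> tails A] --> (0 : X).

Definition weak_right_ergodic (A : net (bounded_op X X)) : Prop :=
  (forall i, cco (A i)) /\
  forall x g, (A i x - A i (S g x) : weak X) @[i --> tails A] --> (0 : weak X).

Definition weak_cluster_fix (A : net (bounded_op X X)) : Prop :=
  forall x, exists2 y, fix_space y &
    cluster ((A i x : weak X) @[i --> tails A]) y.

Definition weak_cvg_fix (A : net (bounded_op X X)) : Prop :=
  forall x, exists2 y, fix_space y &
    (A i x : weak X) @[i --> tails A] --> (y : weak X).

Definition strong_cvg_fix (A : net (bounded_op X X)) : Prop :=
  forall x, exists2 y, fix_space y & A i x @[i --> tails A] --> (y : X).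

End representation.

Section operator_limits.
Context {K : numFieldType} {X : normedModType K}.
Implicit Types (A : net (bounded_op X X)) (P : bounded_op X X).

Definition sot_cvg A P : Prop := A i @[i --> tails A] --> (P : bounded_op X X).

Definition wot_cvg A P : Prop :=
  (A i : wot X) @[i --> tails A] --> (P : wot X).

End operator_limits.

Definition projection_onto_along (K : numFieldType) (X : normedModType K)
    (P : bounded_op X X) (U V : set X) : Prop :=
  [/\ (P * P)%g = P, range P = U & P @^-1` [set 0] = V].

(* Main.v *)
From HB Require Import structures.
Require Import Defs.
From mathcomp Require Import all_boot all_order all_algebra complex ring lra.
From mathcomp Require Import all_classical all_reals all_analysis.

(** Let W be the sum of Fix S and the closed span V of the vectors x - S_g x.
    On W every right ergodic net converges: an operator of the closed convex
    hull of S fixes Fix S pointwise, while A_i (x - S_g x) tends to 0 by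
    definition and the bound of S carries this over to V.  So the whole theorem
    turns on whether W is X.

    What amenability gives is one strong right ergodic net
    (exists_strong_right_ergodic).  For finitely many vectors z_k = x_k - S_(g_k) x_k
    some T in the convex hull of S makes all T z_k small at once.  Otherwise the
    convex set of the families (T z_k)_k stays away from 0 and a functional
    separates it from 0, that is, there are f_k in X' for which the function
    s |-> sum_k f_k (s z_k) has real part at least delta > 0 on S; an invariant
    mean of this function is 0, because each term is the difference of an orbit
    function and its right translate, yet a mean cannot vanish on a function with
    such real parts (is_mean_neq0).  Treating the vectors simultaneously replaces
    the usual passage from weak to strong convergence through Mazur's theorem.

    With such a net A, if Fix S separates Fix S' then X = W.  The set W is closed,
    since for x in its closure A_i x is a Cauchy net, whose limit u is fixed and
    satisfies x - u in V; and a functional that vanishes on W but not at a point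
    off W is fixed by the adjoints and vanishes on Fix S.  The sum is direct,
    since on Fix S and V the net A converges to the identity and to 0.  The limit
    of A is then the mean ergodic projection.  Conversely, a fixed point in the
    closed convex hull of each orbit, or as a weak cluster point of some net along
    each orbit, makes Fix S separate Fix S', because a functional fixed by all
    adjoints is constant on such a hull.

    The separation theorem that both arguments use comes from the Hahn-Banach
    theorem, which is proved through minimal sublinear functionals.  The real
    and complex scalars are treated together by letting the reals act through a
    ring morphism iota into K. *)

Set Implicit Arguments.
Unset Strict Implicit.
Unset Printing Implicit Defensive.

Import Order.TTheory GRing.Theory Num.Theory.
Import numFieldNormedType.Exports.

Local Open Scope classical_set_scope.
Local Open Scope ring_scope.

(** * Sublinear functionals and the Hahn-Banach theorem *)

Section sublinear_functionals.
Context {R : realType} {K : numFieldType} (iota : {rmorphism R -> K}).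
Context {V : lmodType K}.
Implicit Types (p q : V -> R) (x y v : V) (s t : R).

Definition sublinear p : Prop :=
  (forall x y, p (x + y) <= p x + p y) /\
  (forall t x, 0 <= t -> p (iota t *: x) = t * p x).

(** Homogeneity is symmetric under t |-> 1/t, so one inequality suffices; this
    is all that infima of families provide directly. *)
Lemma sublinear_le p : p 0 <= 0 -> (forall x y, p (x + y) <= p x + p y) ->
  (forall t x, 0 < t -> p (iota t *: x) <= t * p x) -> sublinear p.
Proof.
move=> p0 pD pZ; split=> // t x; rewrite le_eqVlt => /predU1P[<-|t0].
  rewrite rmorph0 scale0r mul0r; apply/eqP; rewrite eq_le p0/=.
  by have := pD 0 0; rewrite addr0 -lerBlDr subrr.
apply/eqP; rewrite eq_le pZ//=.
have := pZ t^-1 (iota t *: x); rewrite invr_gt0 scalerA -rmorphM mulVf ?gt_eqF//.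
by rewrite rmorph1 scale1r => /(_ t0); rewrite ler_pdivlMl.
Qed.

Lemma sublinear0 p : sublinear p -> p 0 = 0.
Proof. by case=> _ /(_ 0 0 (lexx _)); rewrite rmorph0 scale0r mul0r. Qed.

Lemma sublinear_oppr p x : sublinear p -> - p (- x) <= p x.
Proof.
move=> ps; have := ps.1 x (- x).
by rewrite subrr sublinear0// -lerBlDr sub0r.
Qed.

(** Three sublinear functionals below arise as such infima: the infimum of a
    chain, the perturbation of a minimal functional in one direction, and the
    gauge of a convex set. *)
Definition pointwise_inf {I : Type} (D : set I) (F : I -> V -> R) : V -> R :=
  fun x => inf [set F i x | i in D].

Section pointwise_inf.
Context {I : Type} (D : set I) (F : I -> V -> R) (b : V -> R).
Context (Fb : forall i x, D i -> b x <= F i x).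

Lemma pointwise_inf_le i x : D i -> pointwise_inf D F x <= F i x.
Proof.
move=> Di; apply: ge_inf; last by exists i.
by exists (b x) => _ [j Dj <-]; exact: Fb.
Qed.

Lemma le_pointwise_inf i0 a x : D i0 ->
  (forall i, D i -> a <= F i x) -> a <= pointwise_inf D F x.
Proof.
move=> Di0 aF; apply: lb_le_inf; first by exists (F i0 x), i0.
by move=> _ [i Di <-]; exact: aF.
Qed.

Lemma pointwise_inf_sublinear i0 : D i0 -> F i0 0 <= 0 ->
  (forall i j x y, D i -> D j ->
     exists2 k, D k & F k (x + y) <= F i x + F j y) ->
  (forall i t x, D i -> 0 < t ->
     exists2 k, D k & F k (iota t *: x) <= t * F i x) ->
  sublinear (pointwise_inf D F).
Proof.
move=> Di0 F0 FD FZ; apply: sublinear_le.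
- by apply: le_trans F0; exact: pointwise_inf_le.
- move=> x y; rewrite -lerBlDl; apply: (le_pointwise_inf Di0) => j Dj.
  rewrite lerBlDl -lerBlDr; apply: (le_pointwise_inf Di0) => i Di.
  rewrite lerBlDr; have [k Dk le_k] := FD i j x y Di Dj.
  exact: le_trans (pointwise_inf_le _ Dk) le_k.
- move=> t x t0; rewrite -ler_pdivrMl//; apply: (le_pointwise_inf Di0) => i Di.
  rewrite ler_pdivrMl//; have [k Dk le_k] := FZ i t x Di t0.
  exact: le_trans (pointwise_inf_le _ Dk) le_k.
Qed.

End pointwise_inf.

(** Zorn's lemma for the reversed pointwise order; a chain is bounded below
    at x by - q (- x), so that its infimum is again sublinear. *)
Lemma minimal_sublinear q : sublinear q ->
  exists p, [/\ sublinear p, forall x, p x <= q x &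
    forall p', sublinear p' -> (forall x, p' x <= p x) -> p' = p].
Proof.
move=> qs; pose T := {p : V -> R | sublinear p /\ forall x, p x <= q x}.
pose R' : rel T := fun a b => `[< forall x, sval b x <= sval a x >].
have [||||[p [ps pq]] pmin] := @Zorn T R'.
- by move=> a; apply/asboolP.
- move=> a b c /asboolP ab /asboolP bc; apply/asboolP => x.
  exact: le_trans (bc x) (ab x).
- move=> [a ?] [b ?] /asboolP /= ab /asboolP /= ba; apply: eq_exist => /=.
  by apply/funext => x; apply/eqP; rewrite eq_le ab ba.
- move=> A Atot; have [->|/set0P[a0 Aa0]] := eqVneq A set0.
    by exists (exist _ q (conj qs (fun x => lexx (q x)))).
  have Fb (a : T) x : A a -> - q (- x) <= sval a x.
    case: a => a [/= as_ aq] _; apply: le_trans (sublinear_oppr _ as_).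
    by rewrite lerN2.
  have infq x : pointwise_inf A (fun a => sval a) x <= q x.
    by apply: le_trans (pointwise_inf_le Fb _ Aa0) _; case: a0 {Aa0} => a [].
  have infs : sublinear (pointwise_inf A (fun a => sval a)).
    apply: (pointwise_inf_sublinear Fb Aa0).
    - by case: a0 {Aa0} => a [as_ ?] /=; rewrite sublinear0.
    - move=> a c x y Aa Ac; have [/asboolP ac|/asboolP ca] := Atot _ _ Aa Ac.
        exists c => //; apply: le_trans ((svalP c).1.1 x y) _.
        by rewrite lerD2r.
      exists a => //; apply: le_trans ((svalP a).1.1 x y) _.
      by rewrite lerD2l.
    - move=> a t x Aa t0; exists a => //.
      by rewrite (svalP a).1.2// ltW.
  exists (exist (fun p => sublinear p /\ forall x, p x <= q x) _
    (conj infs infq)) => a Aa; apply/asboolP => x /=.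
  exact: (pointwise_inf_le Fb x Aa).
- exists p; split=> // p' p's p'p.
  have p'q x : p' x <= q x by exact: le_trans (p'p x) (pq x).
  have := pmin (exist _ p' (conj p's p'q)).
  by move=> /(_ _)/(congr1 sval); apply; apply/asboolP.
Qed.

(** The infimum over t >= 0 of p (v + t y) - t p y is a sublinear functional
    below p, hence equal to p; the value t = 1 gives the inequality. *)
Lemma minimal_sublinear_superadditive p x y : sublinear p ->
  (forall p', sublinear p' -> (forall x, p' x <= p x) -> p' = p) ->
  p x + p y <= p (x + y).
Proof.
move=> ps pmin.
pose D : set R := [set t | 0 <= t].
pose F t v := p (v + iota t *: y) - t * p y.
have D0 : D 0 by rewrite /D/=.
have F0 v : F 0 v = p v by rewrite /F rmorph0 scale0r addr0 mul0r subr0.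
have Fb t v : D t -> - p (- v) <= F t v.
  move=> t0; rewrite lerBrDl -ps.2// lerBlDl -{1}[iota t *: y](addKr v).
  exact: ps.1.
have infp v : pointwise_inf D F v <= p v by rewrite -F0; exact: (pointwise_inf_le Fb).
have /pmin/(_ infp) pE : sublinear (pointwise_inf D F).
  apply: (pointwise_inf_sublinear Fb D0).
  - by rewrite F0 sublinear0.
  - move=> s t u v s0 t0; exists (s + t); first exact: addr_ge0.
    rewrite /F rmorphD scalerDl.
    have := ps.1 (u + iota s *: y) (v + iota t *: y).
    by rewrite addrACA; lra.
  - move=> s t u s0 t0; exists (t * s); first by apply: mulr_ge0 => //; exact: ltW.
    rewrite /F rmorphM -scalerA -scalerDr ps.2 ?(ltW t0)//.
    by rewrite mulrBr mulrA.
have := pointwise_inf_le Fb x (ler01 : D 1).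
by rewrite pE /F rmorph1 scale1r mul1r lerBrDr.
Qed.

(** A minimal sublinear functional below q is additive, hence linear. *)
Lemma sublinear_dominates_linear q : sublinear q ->
  exists phi : V -> R, [/\ forall x y, phi (x + y) = phi x + phi y,
    forall t x, phi (iota t *: x) = t * phi x & forall x, phi x <= q x].
Proof.
move=> /minimal_sublinear[p [ps pq pmin]]; exists p.
have pD x y : p (x + y) = p x + p y.
  by apply/eqP; rewrite eq_le ps.1 minimal_sublinear_superadditive.
have pN x : p (- x) = - p x.
  by apply/eqP; rewrite -addr_eq0 -pD addNr sublinear0.
split=> // t x; have [t0|t0] := leP 0 t; first exact: ps.2.
rewrite -[t]opprK rmorphN scaleNr pN mulNr ps.2// oppr_ge0; exact: ltW.
Qed.

(** The functional v |-> inf over t >= 0 and c in C of N (v + t c) - t delta is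
    sublinear, is at most N, and takes a value at most - delta at - c for c in C;
    a linear functional that it dominates separates C from 0. *)
Lemma separating_real_functional (N : V -> R) (C : set V) (c0 : V) (delta : R) :
  (forall x y, N (x + y) <= N x + N y) ->
  (forall t x, 0 <= t -> N (iota t *: x) = t * N x) ->
  (forall x, N (- x) = N x) ->
  (forall a c s t, C a -> C c -> 0 <= s -> 0 <= t -> s + t = 1 ->
    C (iota s *: a + iota t *: c)) ->
  C c0 -> (forall c, C c -> delta <= N c) ->
  exists phi : V -> R, [/\ forall x y, phi (x + y) = phi x + phi y,
    forall t x, phi (iota t *: x) = t * phi x, forall x, phi x <= N x
    & forall c, C c -> delta <= phi c].
Proof.
move=> ND NZ NN Cconv Cc0 Cdelta.
have N0 : N 0 = 0 by have := NZ 0 0 (lexx _); rewrite rmorph0 scale0r mul0r.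
pose D : set (R * V) := [set i | 0 <= i.1 /\ C i.2].
pose F (i : R * V) v := N (v + iota i.1 *: i.2) - i.1 * delta.
have Fb i v : D i -> - N v <= F i v.
  case: i => t c [/= t0 Cc]; rewrite /F/= lerBrDr.
  apply: (@le_trans _ _ (- N v + t * N c)).
    by rewrite lerD2l ler_wpM2l// Cdelta.
  rewrite addrC -NZ// lerBlDl -{1}[iota t *: c](addKr v).
  by rewrite -(NN v); apply: le_trans (ND _ _) _.
have D0 : D (0, c0) by [].
have F0 v : F (0, c0) v = N v.
  by rewrite /F/= rmorph0 scale0r addr0 mul0r subr0.
have qs : sublinear (pointwise_inf D F).
  apply: (pointwise_inf_sublinear Fb D0).
  - by rewrite F0 N0.
  - move=> [s a] [t c] u v [/= s0 Ca] [/= t0 Cc].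
    have [st0|st0] := eqVneq (s + t) 0.
      exists (0, c0) => //; rewrite F0 /F/=.
      have [-> ->] : s = 0 /\ t = 0 by split; lra.
      by rewrite !rmorph0 !scale0r !addr0 !mul0r !subr0.
    exists (s + t, iota (s / (s + t)) *: a + iota (t / (s + t)) *: c).
      split=> /=; first exact: addr_ge0.
      by apply: Cconv => //; rewrite ?divr_ge0 ?addr_ge0// -mulrDl divff.
    rewrite /F/= scalerDr !scalerA -!rmorphM.
    rewrite ![(s + t) * (_ / _)]mulrC !divfK//.
    have := ND (u + iota s *: a) (v + iota t *: c).
    by rewrite addrACA; lra.
  - move=> [s c] t u [/= s0 Cc] t0; exists (t * s, c).
      by split=> //=; apply: mulr_ge0 => //; exact: ltW.
    rewrite /F/= rmorphM -scalerA -scalerDr NZ ?(ltW t0)//.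
    by rewrite mulrBr mulrA.
have [phi [phiD phiZ phiq]] := sublinear_dominates_linear qs.
exists phi; split=> //.
  by move=> x; rewrite -F0; apply: le_trans (phiq x) (pointwise_inf_le Fb x D0).
move=> c Cc; have D1 : D (1, c) by split; rewrite //= ler01.
have := le_trans (phiq (- c)) (pointwise_inf_le Fb _ D1).
rewrite /F/= rmorph1 scale1r addNr N0 mul1r sub0r.
have := phiD (- c) c; rewrite addNr.
have := phiZ 0 0; rewrite rmorph0 scale0r mul0r => ->; lra.
Qed.

End sublinear_functionals.

(** * Separation of a convex set from the origin *)

Definition convex_stable (K : numFieldType) (V : lmodType K)
    (C : set V) : Prop :=
  forall a c s t, C a -> C c -> 0 <= s -> 0 <= t -> s + t = 1 ->
    C (s *: a + t *: c).

(** The last clause says that the real part of f is at least delta on C, in a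
    form that makes sense for real and complex scalars alike: for r > 0 it
    amounts to delta <= Re (f c), since |r - z|^2 = r^2 - 2 r Re z + |z|^2. *)
Definition separates_from0 (K : numFieldType) (V : lmodType K) (N : V -> K)
    (C : set V) (delta : K) (f : V -> K^o) : Prop :=
  [/\ linear f, forall v, `|f v| <= N v
    & forall c r, C c -> 0 <= r ->
        `|r - f c| ^+ 2 <= r ^+ 2 - 2 * r * delta + `|f c| ^+ 2].

Lemma separation_real (R : realType) (V : lmodType R) (N : V -> R) (C : set V)
    (c0 : V) (delta : R) :
  (forall x y, N (x + y) <= N x + N y) ->
  (forall a x, N (a *: x) = `|a| * N x) ->
  convex_stable C -> C c0 -> (forall c, C c -> delta <= N c) ->
  exists f, separates_from0 N C delta f.
Proof.
move=> ND NZ Cconv Cc0 Cdelta.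
have NN x : N (- x) = N x by rewrite -scaleN1r NZ normrN1 mul1r.
have [||||||phi [phiD phiZ phiN phiC]] := @separating_real_functional R R idfun V N C c0 delta.
- exact: ND.
- by move=> t x t0; rewrite NZ ger0_norm.
- exact: NN.
- exact: Cconv.
- exact: Cc0.
- exact: Cdelta.
exists phi; split=> [a x y|v|c r Cc r0].
- by rewrite phiD phiZ.
- rewrite ler_norml phiN andbT -NN lerNl; apply: le_trans (phiN _).
  have := phiZ (-1) v; rewrite scaleN1r => ->; lra.
- rewrite !real_normK ?num_real//; have := ler_wpM2l r0 (phiC _ Cc); lra.
Qed.

(** The separating functional is the complex functional phi v - i phi (i v)
    whose real part is the real functional phi. *)
Lemma separation_complex (R : realType) (V : lmodType R[i]) (N : V -> R[i])
    (C : set V) (c0 : V) (delta : R[i]) :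
  (forall x y, N (x + y) <= N x + N y) ->
  (forall a x, N (a *: x) = `|a| * N x) ->
  (forall x, 0 <= N x) ->
  convex_stable C -> C c0 -> 0 <= delta ->
  (forall c, C c -> delta <= N c) ->
  exists f, separates_from0 N C delta f.
Proof.
move=> ND NZ N0 Cconv Cc0 delta0 Cdelta.
pose Nr v := complex.Re (N v).
have NE v : N v = (Nr v)%:C%C.
  by have := N0 v; rewrite /Nr; case: (N v) => a b; rewrite lecE/= => /andP[/eqP->].
pose d := complex.Re delta.
have dE : delta = d%:C%C.
  by move: delta0; rewrite /d; case: (delta) => a b; rewrite lecE/= => /andP[/eqP->].
have [||||||phi [phiD phiZ phiN phiC]] :=
    @separating_real_functional R R[i] (real_complex R) V Nr C c0 d.
- by move=> x y; have := ND x y; rewrite !NE -rmorphD lecR.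
- move=> t x t0; rewrite {1}/Nr NZ ger0_norm ?lecR// NE.
  by rewrite -rmorphM.
- by move=> x; rewrite /Nr -scaleN1r NZ normrN1 mul1r.
- move=> a c s t Ca Cc s0 t0 st; apply: Cconv; rewrite ?lecR//.
  by rewrite -rmorphD st.
- by [].
- by move=> c /Cdelta; rewrite dE NE lecR.
have phi0 : phi 0 = 0 by have := phiZ 0 0; rewrite scaler0 mul0r.
have phiB x : phi (- x) = - phi x.
  by apply/eqP; rewrite -addr_eq0 -phiD addNr phi0.
pose f v : R[i] := (phi v -i* phi ('i%C *: v))%C.
have fD x y : f (x + y) = f x + f y.
  by rewrite /f scalerDr !phiD opprD.
have phiE a b x : phi ((a +i* b)%C *: x) = a * phi x + b * phi ('i%C *: x).
  have -> : (a +i* b)%C = a%:C%C + b%:C%C * 'i%C by simpc.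
  by rewrite scalerDl phiD phiZ -scalerA phiZ.
have fZ a x : f (a *: x) = a * f x.
  case: a => a b; rewrite /f scalerA.
  have -> : ('i * (a +i* b) = (- b) +i* a)%C by simpc.
  rewrite phiE [phi ((- b +i* a)%C *: _)]phiE; simpc; congr (_ +i* _)%C; ring.
exists f; split=> [a x y|v|c r Cc r0].
- by rewrite fD fZ.
- have [->|fv0] := eqVneq (f v) 0; first by rewrite normr0.
  (* multiplying v by a phase makes the value of f real, where f equals phi *)
  pose u := `|f v| / f v.
  have nu : `|u| = 1 by rewrite normf_div normr_id divff// normr_eq0.
  have fuv : f (u *: v) = `|f v| by rewrite fZ divfK.
  have -> : N v = N (u *: v) by rewrite NZ nu mul1r.
  have <- : (phi (u *: v))%:C%C = `|f v|.
    have := normr_ge0 (f v); rewrite -fuv lecE/= => /andP[/eqP fi0 _].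
    by rewrite /f fi0.
  by rewrite NE lecR.
- have rE : r = (complex.Re r)%:C%C.
    by move: r0; case: (r) => a b; rewrite lecE/= => /andP[/eqP->].
  rewrite -!add_Re2_Im2 rE dE -[2]/(2%:R) -(rmorph_nat (real_complex R)).
  rewrite -!(rmorphXn, rmorphM) /= -rmorphB -rmorphD/= lecR/=.
  have r'0 : 0 <= complex.Re r by rewrite rE lecR in r0.
  have := ler_wpM2l r'0 (phiC _ Cc); lra.
Qed.

Lemma separation (K : numFieldType) (hK : real_or_complex K) (V : lmodType K)
    (N : V -> K) (C : set V) (c0 : V) (delta : K) :
  (forall x y, N (x + y) <= N x + N y) ->
  (forall a x, N (a *: x) = `|a| * N x) ->
  (forall x, 0 <= N x) ->
  convex_stable C -> C c0 -> 0 <= delta ->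
  (forall c, C c -> delta <= N c) ->
  exists f, separates_from0 N C delta f.
Proof.
case: hK => R [eK|eK]; subst K; last exact: separation_complex.
by move=> ND NZ _ Cconv Cc0 _; exact: separation_real ND NZ Cconv Cc0.
Qed.

(** * Means *)

Section means.
Context {K : numFieldType} {T : topologicalType}.
Implicit Types (f h : bounded_continuous K T) (m : {linear bounded_continuous K T -> K^o}).

Lemma bcE a f h s : (a *: f + h) s = a * f s + h s.
Proof. by []. Qed.

Lemma bcB f h s : (f - h) s = f s - h s.
Proof. by []. Qed.

Lemma bc_sum (I : Type) (r : seq I) (F : I -> bounded_continuous K T) s :
  (\sum_(i <- r) F i) s = \sum_(i <- r) F i s.
Proof.
elim/big_ind2 : _ => // x1 x2 y1 y2 <- <-.
by [].
Qed.

Lemma is_mean_le m f (b : K) : is_mean m -> 0 < b ->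
  (forall s, `|f s| <= b) -> `|m f| <= b.
Proof.
move=> [_ [mub _]] b0 fb.
have := mub `|m (b^-1 *: f)|; rewrite linearZ/= normrM gtr0_norm ?invr_gt0//.
rewrite mulrC ler_pdivrMr// mul1r; apply.
exists (b^-1 *: f); last by rewrite linearZ/= normrM gtr0_norm ?invr_gt0// mulrC.
move=> s; rewrite -[b^-1 *: f]addr0 bcE addr0 normrM gtr0_norm ?invr_gt0//.
by rewrite mulrC ler_pdivrMr// mul1r.
Qed.

Lemma is_mean_inhabited m : is_mean m -> inhabited T.
Proof.
move=> [m1 _]; apply: contrapT => T0; have : (0 : K^o) = 1.
  rewrite -m1 -(linear0 m); congr (m _); apply: val_inj; apply/funext => t.
  by case: T0.
by move/esym/eqP; rewrite oner_eq0.
Qed.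

(** For large r the values of h lie in a disc around r of a radius rho < r.
    Hence r - m h, the mean of r - h, has absolute value at most rho. *)
Lemma is_mean_neq0 m h (b delta : K) : is_mean m -> 0 < delta ->
  (forall s, `|h s| <= b) ->
  (forall s r, 0 <= r ->
    `|r - h s| ^+ 2 <= r ^+ 2 - 2 * r * delta + `|h s| ^+ 2) ->
  m h <> 0.
Proof.
move=> mm delta0 hb hdisc mh0; have [s0] := is_mean_inhabited mm.
have b0 : 0 <= b by apply: le_trans (hb s0).
(* with this r the hypothesis yields |r - h s|^2 <= r^2 - 2 delta *)
pose r := b ^+ 2 / delta + 1.
have r0 : 0 < r by rewrite ltr_wpDl// divr_ge0 ?exprn_ge0 ?(ltW delta0).
have rdelta : r * delta = b ^+ 2 + delta by rewrite mulrDl mul1r divfK ?gt_eqF.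
have gr s : `|r - h s| ^+ 2 <= r ^+ 2 - 2 * delta.
  apply: le_trans (hdisc s r (ltW r0)) _.
  apply: (@le_trans _ _ (r ^+ 2 - 2 * r * delta + b ^+ 2)).
    by rewrite lerD2l ler_pXn2r// nnegrE.
  rewrite -mulrA rdelta -addrA lerD2l mulrDr opprD addrAC gerDr.
  by rewrite mulr_natl mulr2n opprD addrNK oppr_le0 exprn_ge0.
(* rho^2 = r^2 - 2 delta + (delta / r)^2 *)
pose rho := r - delta / r.
have r2 : 2 * delta <= r ^+ 2 by rewrite -subr_ge0; apply: le_trans (gr s0); rewrite exprn_ge0.
have rho0 : 0 < rho.
  rewrite subr_gt0 ltr_pdivrMr// -expr2; apply: lt_le_trans r2.
  by rewrite mulr_natl mulr2n ltrDl.
have : `|m (r *: bc_one K T + (-1) *: h)| <= rho.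
  apply: is_mean_le => // s.
  rewrite bcE -[_ *: h]addr0 bcE addr0 mulN1r mulr1.
  rewrite -(@ler_pXn2r _ 2)// ?nnegrE ?(ltW rho0)//.
  apply: le_trans (gr s) _.
  rewrite /rho sqrrB [r * _]mulrC divfK ?gt_eqF// mulr_natl lerDl.
  by rewrite exprn_ge0// divr_ge0 ?ltW.
rewrite linearD !linearZ/= mh0 scaler0 addr0 mm.1 /GRing.scale/= mulr1 gtr0_norm//.
by rewrite lerBrDr gerDl lt_geF// divr_gt0.
Qed.

End means.

(** * Convex hulls and closures *)

Section convexity.
Context {K : numFieldType} {E : lmodType K}.
Implicit Types (A C : set E).

Lemma convex_setP C : convex_set C <-> convex_stable C.
Proof.
split=> [Cconv a c s t Ca Cc s0 t0 st|Cconv x y l].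
  have s1 : s <= 1 by rewrite -st lerDl.
  have := Cconv a c (Itv01 s0 s1); rewrite !inE => /(_ Ca Cc).
  suff <- : 1 - s = t by [].
  by rewrite -st addrC addKr.
rewrite !inE => Cx Cy; apply: Cconv => //.
  by rewrite /unstable.onem subr_ge0.
exact: subrKC.
Qed.

Lemma convex_hull_convex A : convex_stable (convex_hull A).
Proof.
move=> a c s t hA hC s0 t0 st D [Dconv AD].
have /convex_setP := Dconv; apply => //; [exact: hA|exact: hC].
Qed.

Lemma sub_convex_hull A : A `<=` convex_hull A.
Proof. exact: sub_gen_smallest. Qed.

Lemma convex_hull_min A C : A `<=` C -> convex_stable C ->
  convex_hull A `<=` C.
Proof. by move=> AC /convex_setP Cconv; exact: smallest_sub. Qed.

End convexity.

Lemma le_normM (K : numFieldType) (a M b : K) :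
  0 <= a -> 0 <= b -> a <= M * b -> a <= `|M| * b.
Proof.
move=> a0 b0 aMb; have Mb0 := le_trans a0 aMb.
by rewrite -(ger0_norm b0) -normrM ger0_norm.
Qed.

Section bounded_operators.
Context {K : numFieldType} {X Y : normedModType K}.

Lemma bop_norm_le (T : bounded_op X Y) :
  exists2 M : K, 0 <= M & forall x, `|T x| <= M * `|x|.
Proof.
have [M TM] := bop_bounded T; exists `|M| => // x.
exact: le_normM _ _ (TM x).
Qed.

Lemma bop_neq0 (T : bounded_op X Y) : T <> 0 -> exists x, T x <> 0.
Proof.
move=> T0; apply: contrapT => Tx; apply: T0; apply: val_inj.
by apply/funext => x; apply: contrapT => Tx0; apply: Tx; exists x.
Qed.

Definition mk_bounded_op (f : X -> Y) (M : K) (lf : linear f)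
  (fM : forall x, `|f x| <= M * `|x|) : bounded_op X Y :=
  @BoundedOp K X Y f (asboolT (conj lf (ex_intro _ M fM))).

Lemma bop_addE (T U : bounded_op X Y) x : (T + U) x = T x + U x.
Proof. by []. Qed.

Lemma bop_scaleE a (T : bounded_op X Y) x : (a *: T) x = a *: T x.
Proof. by []. Qed.

End bounded_operators.

Section closures.
Context {K : numFieldType} {X : normedModType K}.
Implicit Types (A : set X) (x y : X).

Lemma closure_normP A x :
  closure A x <-> forall e : K, 0 < e -> exists2 a, A a & `|x - a| < e.
Proof.
split=> [Ax e e0|Ax B /nbhs_ballP[e /= e0 eB]].
  by have [a [Aa xa]] := Ax _ (nbhsx_ballx x _ e0); exists a; rewrite // -ball_normE in xa *.
have [a Aa xa] := Ax e e0; exists a; split=> //; apply: eB.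
by rewrite -ball_normE.
Qed.

Lemma closure_convex A :
  convex_stable A -> convex_stable (closure A).
Proof.
move=> Aconv x y s t /closure_normP Ax /closure_normP Ay s0 t0 st.
apply/closure_normP => e e0.
have [[a Aa xa] [b Ab yb]] := (Ax e e0, Ay e e0).
exists (s *: a + t *: b); first exact: Aconv.
rewrite opprD addrACA -!scalerBr; apply: le_lt_trans (ler_normD _ _) _.
rewrite !normrZ !ger0_norm// -[ltRHS]mul1r -st mulrDl.
have [s00|s00] := eqVneq s 0.
  by rewrite s00 add0r in st; rewrite s00 st !mul0r !mul1r !add0r.
apply: ltr_leD; last by rewrite ler_wpM2l// ltW.
by rewrite ltr_pM2l// lt_neqAle eq_sym s00.
Qed.

Lemma closed_norm_le (c : K) : 0 <= c -> closed [set x : X | `|x| <= c].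
Proof.
move=> c0 x /closure_normP cx /=; rewrite real_leNgt ?ger0_real//; apply/negP => cltx.
have [a /= ac xa] := cx (`|x| - c) (ltac:(by rewrite subr_gt0)).
have : `|x| < `|x| - c + c.
  rewrite -{1}(subrK a x); apply: le_lt_trans (ler_normD _ _) _.
  exact: ltr_leD.
by rewrite subrK ltxx.
Qed.

Lemma closed_set1 x : closed [set x].
Proof. exact/accessible_closed_set1/hausdorff_accessible/norm_hausdorff. Qed.

End closures.

(** * The closed convex hull of a representation *)

Section closed_convex_hull.
Context {K : numFieldType} {G : semitopologicalSemigroupType}.
Context {X : normedModType K} (S : bounded_rep G X).

Lemma cco_min (Q : set (bounded_op X X)) : closed Q ->
  convex_stable Q -> (forall g, Q (S g)) -> cco S `<=` Q.
Proof.
move=> Qcl Qconv SQ; rewrite (closure_id Q).1//; apply: closure_subset.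
by apply: convex_hull_min => // _ [g _ <-]; exact: SQ.
Qed.

(** The properties of operators in the closed convex hull come from suitable C:
    a ball, a point, a level set of a functional, the closed convex hull of an
    orbit, or a translate of the closed span of the displacements. *)
Lemma cco_eval (C : set X) x : closed C -> convex_stable C ->
  (forall g, C (S g x)) -> forall T, cco S T -> C (T x).
Proof.
move=> Ccl Cconv SC T; apply: (@cco_min [set T : bounded_op X X | C (T x)]).
- apply: (closed_comp _ Ccl) => U _; exact: bop_eval_continuous.
- move=> U W s t CU CW s0 t0 st; rewrite /mkset bop_addE !bop_scaleE.
  exact: Cconv.
- exact: SC.
Qed.

Lemma closed_eq_level (Y : normedModType K) (f : bounded_op X Y) (y : Y) :
  closed [set x | f x = y].
Proof.
rewrite (_ : mkset _ = f @^-1` [set y])//.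
apply: closed_comp => [x _|]; first exact: bop_continuous.
exact: closed_set1.
Qed.

Lemma convex_eq_level (V W : lmodType K) (f : {linear V -> W}) (y : W) :
  convex_stable [set x | f x = y].
Proof.
move=> a c s t /= <- fc s0 t0 st.
by rewrite linearP linearZ/= fc -scalerDl st scale1r.
Qed.

Lemma cco_level (Y : normedModType K) (f : bounded_op X Y) x :
  (forall g, f (S g x) = f x) -> forall T, cco S T -> f (T x) = f x.
Proof.
move=> fS; apply: (@cco_eval [set y | f y = f x] x) => //.
  exact: closed_eq_level.
exact: convex_eq_level.
Qed.

Lemma cco_bounded : exists2 M : K, 0 <= M &
  forall T, cco S T -> forall x, `|T x| <= M * `|x|.
Proof.
have [M SM] := rep_bounded S; exists `|M| => // T ST x.
have SM' g : `|S g x| <= `|M| * `|x| by apply: le_normM (SM g x).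
apply: (@cco_eval [set y | `|y| <= `|M| * `|x|] x) => //.
  by apply: closed_norm_le; rewrite mulr_ge0.
move=> a c s t /= ha hc s0 t0 st.
apply: le_trans (ler_normD _ _) _; rewrite !normrZ (ger0_norm s0) (ger0_norm t0).
by rewrite -[leRHS]mul1r -st [leRHS]mulrDl lerD ?ler_wpM2l.
Qed.

Lemma cco_orbit_eval x T : cco S T -> cco_orbit S x (T x).
Proof.
apply: cco_eval; first exact: closed_closure.
  by apply: closure_convex; exact: convex_hull_convex.
move=> g; apply: subset_closure; apply: sub_convex_hull; by exists g.
Qed.

Lemma hull_cco : convex_hull (range S) `<=` cco S.
Proof. exact: subset_closure. Qed.

Lemma cco_closed : closed (cco S).
Proof. exact: closed_closure. Qed.

End closed_convex_hull.

(** * Amenability makes finitely many displacements small *)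

Section amenable_representation.
Context {K : numFieldType} {G : semitopologicalSemigroupType}.
Context {X : normedModType K} (S : bounded_rep G X).

Lemma orbit_functional_subproof (psi : dual X) (x : X) :
  (fun s : rep_semigroup S => psi ((val s : bounded_op X X) x)) \in
  @bounded_continuous_pred K (rep_semigroup S).
Proof.
rewrite inE; split.
  move=> s; apply: (continuous_comp
    (f := fun s : rep_semigroup S => (val s : bounded_op X X) x) (g := psi)).
    exact: rep_val_continuous.
  exact: bop_continuous.
have [N N0 psiN] := bop_norm_le psi; have [M M0 SM] := cco_bounded S.
exists (N * (M * `|x|)) => -[T ST] /=; apply: le_trans (psiN _) _.
rewrite ler_wpM2l// SM//; apply: subset_closure; apply: sub_convex_hull.
exact: set_mem ST.
Qed.

Definition orbit_functional psi x : bounded_continuous K (rep_semigroup S) :=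
  BoundedContinuous (orbit_functional_subproof psi x).

Definition rep_elt (g : G) : rep_semigroup S :=
  exist _ (S g) (mem_set (ex_intro2 _ _ g I erefl)).

(** Here the side on which amenability is assumed matches the side on which
    ergodic nets are multiplied by S_g. *)
Lemma orbit_functional_rtranslate psi x g :
  orbit_functional psi (S g x) = rtranslate (rep_elt g) (orbit_functional psi x).
Proof. exact: val_inj. Qed.

(** Separation is applied in the space of all families of vectors indexed by
    X * G, with the seminorm that sums the norms of the entries in F; so the
    separating functional depends on these entries only, and is a sum of
    functionals psi p of single entries.  Along an orbit it becomes the
    function h, whose mean vanishes by invariance. *)
Lemma amenable_displacement_hull (hK : real_or_complex K)
    (hS : right_amenable K (rep_semigroup S)) (F : seq (X * G)) (e : K) :
  0 < e -> exists2 T, convex_hull (range S) T &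
    forall p, p \in F -> `|T p.1 - T (S p.2 p.1)| < e.
Proof.
move=> e0; apply: contrapT => noT; have [m [mm minv]] := hS.
have [[_ /set_mem[g0 _ _]]] := is_mean_inhabited mm.
pose disp (T : bounded_op X X) : X * G -> X := fun p => T p.1 - T (S p.2 p.1).
(* without repetitions, so that psi p has norm at most 1 *)
pose N (v : X * G -> X) := \sum_(p <- undup F) `|v p|.
pose C := disp @` convex_hull (range S).
have N0 v : 0 <= N v by exact: sumr_ge0.
have ND v w : N (v + w) <= N v + N w.
  by rewrite -big_split; apply: ler_sum => p _; exact: ler_normD.
have NZ a v : N (a *: v) = `|a| * N v.
  by rewrite mulr_sumr; apply: eq_bigr => p _; rewrite -normrZ.
have Cconv : convex_stable C.
  move=> _ _ s t [T hT <-] [U hU <-] s0 t0 st.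
  exists (s *: T + t *: U); first exact: convex_hull_convex.
  apply/funext => p; rewrite /disp !bop_addE !bop_scaleE.
  by rewrite opprD addrACA -!scalerBr.
have CN c : C c -> e <= N c.
  move=> [T hT <-]; rewrite real_leNgt ?(gtr0_real e0) ?(ger0_real (N0 _))//.
  apply/negP => NT; apply: noT; exists T => // p pF.
  apply: le_lt_trans NT; rewrite /N (bigD1_seq p) ?mem_undup ?undup_uniq//=.
  by rewrite lerDl sumr_ge0.
have Cc0 : C (disp (S g0)) by exists (S g0) => //; apply: sub_convex_hull; exists g0.
have [f [flin fN fdisc]] := separation hK ND NZ N0 Cconv Cc0 (ltW e0) CN.
pose fl : {linear (X * G -> X) -> K^o} :=
  HB.pack f (GRing.isLinear.Build K (X * G -> X) K^o *:%R f flin).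
pose delta_at p (x : X) : X * G -> X := fun q => if q == p then x else 0.
have psi_lin p : linear (fun x => f (delta_at p x) : K^o).
  move=> a x y; rewrite -flin; congr f; apply/funext => q.
  rewrite -[RHS]/(a *: delta_at p x q + delta_at p y q) /delta_at.
  by case: ifP => // _; rewrite scaler0 addr0.
have psi_bound p x : `|f (delta_at p x)| <= 1 * `|x|.
  rewrite mul1r; apply: le_trans (fN _) _; rewrite /N.
  have [pF|pF] := boolP (p \in F).
    rewrite (bigD1_seq p) ?mem_undup ?undup_uniq//= big1 ?addr0.
      by rewrite /delta_at eqxx.
    by move=> q /negPf qp; rewrite /delta_at qp normr0.
  rewrite big1_seq// => q /andP[_]; rewrite mem_undup /delta_at => qF.
  by case: eqP => [qp|_]; rewrite ?normr0// -qp qF in pF *.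
pose psi p : dual X := mk_bounded_op (psi_lin p) (psi_bound p).
pose h := \sum_(p <- undup F)
  (orbit_functional (psi p) p.1 - orbit_functional (psi p) (S p.2 p.1)).
have hE s : h s = f (disp (val s)).
  have -> : h s = \sum_(p <- undup F) f (delta_at p (disp (val s) p)).
    rewrite /h bc_sum; apply: eq_bigr => p _; rewrite bcB.
    exact/esym/(linearB (psi p)).
  rewrite -(linear_sum fl) /=.
  set v := \sum_(p <- _) _; set w := disp _.
  apply/eqP; rewrite -subr_eq0 -normr_le0.
  rewrite -[f v - f w](linearB fl); apply: le_trans (fN _) _.
  rewrite /N big1_seq// => q /andP[_ qF].
  rewrite -[(v - w) q]/(v q - w q) /v fct_sumE.
  rewrite (bigD1_seq q) ?undup_uniq//= big1 => [|p /negPf pq].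
    by rewrite addr0 /delta_at eqxx subrr normr0.
  by rewrite /delta_at eq_sym pq.
have /[!inE] -[_ [b hb]] := bc_subproof h.
apply: (is_mean_neq0 mm e0 hb) => [s r r0|].
  rewrite hE; apply: fdisc => //; exists (val s) => //.
  by apply: sub_convex_hull; exact: set_mem (valP s).
rewrite /h linear_sum big1// => p _.
by rewrite linearB/= orbit_functional_rtranslate minv subrr.
Qed.

End amenable_representation.

(** * Nets and operator topologies *)

#[local] Instance tails_filter (T : Type) (A : net T) : ProperFilter (tails A).
Proof.
split.
  by move=> [i /(_ i (net_le_refl i))].
split.
- by case: (net_inhabited A) => i; exists i.
- move=> B C [i hi] [j hj]; have [k [ik jk]] := net_directed i j.
  by exists k => l kl; split; [apply: hi|apply: hj]; exact: net_le_trans kl.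
- by move=> B C BC [i hi]; exists i => j ij; exact/BC/hi.
Qed.

Lemma cvg_initial (Y : choiceType) (Z : topologicalType) (w : Y -> Z)
    (F : set_system Y) (FF : Filter F) (y : Y) :
  F --> (y : initial_topology w) <-> w z @[z --> F] --> w y.
Proof.
split=> [Fy|Fwy].
  exact: cvg_comp Fy (@initial_continuous _ _ w y).
move=> B [_ [[U oU <-] Uy] UB]; apply: filterS UB _.
by apply: Fwy; apply: open_nbhs_nbhs.
Qed.

Lemma cvg_prod_topology (I : choiceType) (Z : topologicalType)
    (F : set_system (I -> Z)) (FF : Filter F) (h : I -> Z) :
  F --> (h : prod_topology (fun=> Z)) <->
  forall i, g i @[g --> F] --> h i.
Proof.
split=> [Fh i|Fh].
  exact: cvg_comp Fh (@proj_continuous I (fun=> Z) i h).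
by apply/cvg_sup => i; apply/cvg_initial; exact: Fh.
Qed.

Section operator_topologies.
Context {K : numFieldType} {X : normedModType K}.
Context {I : Type} {F : set_system I} {FF : Filter F}.

Lemma weak_cvgP (u : I -> X) (y : X) :
  (u i : weak X) @[i --> F] --> (y : weak X) <->
  forall f : dual X, f (u i) @[i --> F] --> f y.
Proof.
split=> [/cvg_initial/pointwise_cvgP uy f|uy]; first exact: uy f.
by apply/cvg_initial/pointwise_cvgP.
Qed.

Lemma strong_weak_cvg (u : I -> X) (y : X) : u i @[i --> F] --> y ->
  (u i : weak X) @[i --> F] --> (y : weak X).
Proof.
move=> uy; apply/weak_cvgP => f; exact: cvg_comp uy (@bop_continuous _ _ _ f y).
Qed.

Lemma sot_cvgP (T : I -> bounded_op X X) (P : bounded_op X X) :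
  T i @[i --> F] --> (P : bounded_op X X) <->
  forall x, T i x @[i --> F] --> P x.
Proof.
split=> [/cvg_initial/pointwise_cvgP TP x|TP]; first exact: TP x.
by apply/cvg_initial/pointwise_cvgP.
Qed.

Lemma wot_cvgP (T : I -> bounded_op X X) (P : bounded_op X X) :
  (T i : wot X) @[i --> F] --> (P : wot X) <->
  forall x, (T i x : weak X) @[i --> F] --> (P x : weak X).
Proof.
split=> [/cvg_initial/cvg_prod_topology TP x|TP]; first exact: TP x.
by apply/cvg_initial/cvg_prod_topology.
Qed.

End operator_topologies.

(** * Existence of ergodic nets *)

Section ergodic_nets.
Context {K : numFieldType} {G : semitopologicalSemigroupType}.
Context {X : normedModType K} (S : bounded_rep G X).

(** Indices are pairs of a finite list of displacements and a tolerance, the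
    operator of such a pair making each of these displacements smaller than the
    tolerance. *)
Lemma exists_strong_right_ergodic (hK : real_or_complex K) :
  right_amenable K (rep_semigroup S) -> exists A, strong_right_ergodic S A.
Proof.
move=> hS; pose index : Type := (seq (X * G) * {e : K | 0 < e})%type.
have ex (i : index) : exists T, convex_hull (range S) T /\
    forall p, p \in i.1 -> `|T p.1 - T (S p.2 p.1)| < sval i.2.
  have [T hT Te] := amenable_displacement_hull hK hS i.1 (svalP i.2).
  by exists T.
have [A Aprop] := choice ex.
pose le (i j : index) := {subset i.1 <= j.1} /\ sval j.2 <= sval i.2.
have le_trans i j k : le i j -> le j k -> le i k.
  move=> [ij eij] [jk ejk]; split; first by move=> p /ij/jk.
  exact: le_trans ejk eij.
have le_dir i j : exists k, le i k /\ le j k.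
  have [ej|ei] := real_leP (gtr0_real (svalP i.2)) (gtr0_real (svalP j.2)).
    exists (i.1 ++ j.1, i.2); split; split=> //= p pF;
      by rewrite mem_cat pF ?orbT.
  exists (i.1 ++ j.1, j.2); split; split=> //=; rewrite ?(ltW ei)// => p pF;
    by rewrite mem_cat pF ?orbT.
pose N := @Net _ index le A (inhabits ([::], exist _ 1 ltr01))
  (fun i => conj (fun p pi => pi) (lexx _)) le_trans le_dir.
exists N.
split=> [i|x g] /=; first by apply: hull_cco; exact: (Aprop i).1.
have FN : Filter (tails N) := tails_filter N.
apply/(@cvgr0Pnorm_lt _ _ _ _ FN) => e e0.
exists ([:: (x, g)], exist _ e e0) => j [/(_ (x, g)) xgj ej].
apply: lt_le_trans ej; apply: (Aprop j).2 (x, g) _.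
by apply: xgj; rewrite mem_head.
Qed.

Lemma strong_weak_right_ergodic A :
  strong_right_ergodic S A -> weak_right_ergodic S A.
Proof. by case=> cA A0; split=> // x g; exact/strong_weak_cvg/A0. Qed.

End ergodic_nets.

(** * Convergence of ergodic nets on the sum of fixed space and displacements *)

Section linear_span.
Context {K : numFieldType} {E : lmodType K}.
Implicit Types (A : set E).

Lemma lin_sub A : A `<=` lin A.
Proof.
move=> x Ax; exists 1%N, (fun=> 1), (fun=> x); split=> //.
by rewrite big_ord1 scale1r.
Qed.

Lemma lin0 A : lin A 0.
Proof.
by exists 0%N, (fun=> 0), (fun=> 0); split=> [[]//|]; rewrite big_ord0.
Qed.

Lemma lin_linear A a x y : lin A x -> lin A y -> lin A (a *: x + y).
Proof.
move=> [n [c [u [uA ->]]]] [m [d [v [vA ->]]]].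
exists (n + m)%N, (fun i => match fintype.split i with inl j => a * c j | inr k => d k end),
  (fun i => match fintype.split i with inl j => u j | inr k => v k end); split.
  by move=> i; case: (fintype.split i).
rewrite big_split_ord/= scaler_sumr; congr (_ + _); apply: eq_bigr => i _.
  by rewrite (unsplitK (inl i)) scalerA.
by rewrite (unsplitK (inr i)).
Qed.

Lemma subspace_convex (W : set E) : W 0 ->
  (forall a x y, W x -> W y -> W (a *: x + y)) -> convex_stable W.
Proof.
move=> W0 Wlin a c s t Wa Wc _ _ _; rewrite -[t *: c]addr0.
by apply: (Wlin) => //; exact: Wlin.
Qed.

Lemma subspaceB (W : set E) x y :
  (forall a x y, W x -> W y -> W (a *: x + y)) -> W x -> W y -> W (x - y).
Proof. by move=> Wlin Wx Wy; rewrite addrC -scaleN1r; exact: Wlin. Qed.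

End linear_span.

Section decomposition.
Context {K : numFieldType} {G : semitopologicalSemigroupType}.
Context {X : normedModType K} (S : bounded_rep G X).

Lemma fix_space_linear a x y :
  fix_space S x -> fix_space S y -> fix_space S (a *: x + y).
Proof. move=> Sx Sy g; by rewrite linearP/= Sx Sy. Qed.

Lemma fix_space0 : fix_space S 0.
Proof. by move=> g; rewrite linear0. Qed.

Lemma cco_fix x T : fix_space S x -> cco S T -> T x = x.
Proof.
move=> Sx; apply: (@cco_eval _ _ _ S [set x] x); first exact: closed_set1.
  by move=> a c s t -> -> _ _ st; rewrite /set1/= -scalerDl st scale1r.
exact: Sx.
Qed.

Lemma fix_dualP (f : dual X) :
  fix_dual S f <-> forall g x, f (S g x) = f x.
Proof.
split=> [Sf g x|Sf g]; first by rewrite -[in RHS](Sf g).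
by apply: val_inj; apply/funext => x; exact: Sf.
Qed.

Lemma fix_dual_cco (f : dual X) x T : fix_dual S f -> cco S T -> f (T x) = f x.
Proof. by move=> /fix_dualP Sf; apply: cco_level. Qed.

Lemma fix_space_closed : closed (fix_space S).
Proof.
move=> x Sx g; suff Cg : closed [set y | S g y = y].
  by apply: Cg; apply: closure_subset Sx => y /(_ g).
have -> : [set y | S g y = y] = (fun y => S g y - y) @^-1` [set 0].
  by apply/seteqP; split=> [y /= ->|y /= /subr0_eq//]; rewrite subrr.
apply: closed_comp => [y _|].
  by apply: continuousB => //; exact: bop_continuous.
exact: closed_set1.
Qed.

Lemma clin_linear a x y :
  clin_rg_sub S x -> clin_rg_sub S y -> clin_rg_sub S (a *: x + y).
Proof.
move=> /closure_normP Sx /closure_normP Sy; apply/closure_normP => e e0.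
have b0 : 0 < `|a| + 1 by rewrite ltr_wpDl.
have [x' Sx' xx'] := Sx (e / (2 * (`|a| + 1))) (ltac:(by rewrite divr_gt0// mulr_gt0)).
have [y' Sy' yy'] := Sy (e / 2) (ltac:(by rewrite divr_gt0)).
exists (a *: x' + y'); first exact: lin_linear.
rewrite opprD addrACA -scalerBr; apply: le_lt_trans (ler_normD _ _) _.
rewrite [ltRHS]splitr ler_ltD// normrZ.
apply: (@le_trans _ _ ((`|a| + 1) * `|x - x'|)); first by rewrite ler_wpM2r// lerDl.
apply: le_trans (ler_wpM2l (ltW b0) (ltW xx')) _.
by rewrite invfM mulrCA [_ * (_^-1 * _)]mulrC mulrAC -mulrA mulfV ?gt_eqF// mulr1.
Qed.

Lemma clin0 : clin_rg_sub S 0.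
Proof. by apply: subset_closure; exact: lin0. Qed.

Lemma clin_displacement x T : cco S T -> clin_rg_sub S (x - T x).
Proof.
apply: (@cco_eval _ _ _ S [set y | clin_rg_sub S (x - y)] x).
- apply: (@closed_comp _ _ (fun y => x - y)); last exact: closed_closure.
  by move=> y _; apply: continuousB; [exact: cst_continuous|].
- move=> y z s t /= Sy Sz s0 t0 st.
  have -> : x - (s *: y + t *: z) = s *: (x - y) + t *: (x - z).
    by rewrite !scalerBr addrACA -scalerDl st scale1r opprD.
  exact: (subspace_convex clin0 clin_linear).
- by move=> g; apply: subset_closure; apply: lin_sub; exists x, g.
Qed.

Section operator_family.
Context {Y : normedModType K} {I : Type} {F : set_system I} {FF : Filter F}.
Context (B : I -> bounded_op X Y) (M : K).
Context (BM : forall i x, `|B i x| <= M * `|x|).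

(** Stated for a family with values in any normed space, so that it applies
    both to the operators of a strong net and to their composites with a
    functional for a weak net. *)
Lemma clin_cvg0 : 0 <= M ->
  (forall x g, B i (x - S g x) @[i --> F] --> (0 : Y)) ->
  forall v, clin_rg_sub S v -> B i v @[i --> F] --> (0 : Y).
Proof.
move=> M0 B0 v /closure_normP Sv; apply/cvgr0Pnorm_lt => e e0.
have M1 : 0 < M + 1 by rewrite ltr_wpDl.
have [w Sw vw] := Sv (e / 2 / (M + 1)) (ltac:(by rewrite !divr_gt0)).
have Bw : B i w @[i --> F] --> (0 : Y).
  have [n [c [a [aS ->]]]] := Sw.
  elim/big_ind : _ => [|x y Bx By|j _].
  - by under eq_fun do rewrite linear0; exact: cvg_cst.
  - by under eq_fun do rewrite linearD; rewrite -[0]addr0; exact: cvgD.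
  under eq_fun do rewrite linearZ.
  rewrite -[0](scaler0 _ (c j)); apply: cvgZl_tmp.
  by have [x [g ->]] := aS j; exact: B0.
move/cvgr0Pnorm_lt : Bw => /(_ (e / 2) (ltac:(by rewrite divr_gt0))).
apply: filterS => i Bw; rewrite -(subrK w v) linearD.
apply: le_lt_trans (ler_normD _ _) _; rewrite [ltRHS]splitr ler_ltD//.
apply: le_trans (BM _ _) _; apply: (@le_trans _ _ ((M + 1) * `|v - w|)).
  by rewrite ler_wpM2r// lerDl.
by rewrite -ler_pdivlMl// mulrC ltW.
Qed.

End operator_family.

Section nets.
Context (A : net (bounded_op X X)).

Lemma strong_ergodic_cvg u v : strong_right_ergodic S A ->
  fix_space S u -> clin_rg_sub S v -> A i (u + v) @[i --> tails A] --> u.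
Proof.
move=> [cA A0] Su Sv; have [M M0 AM] := cco_bounded S.
under eq_fun do rewrite linearD/= (cco_fix Su (cA _)).
suff Av0 : A i v @[i --> tails A] --> (0 : X).
  by have := cvgD (@cvg_cst _ u _ (tails A) _) Av0; rewrite addr0; apply.
apply: (clin_cvg0 (B := A) (fun i => AM _ (cA i)) M0) Sv => x g.
by under eq_fun do rewrite linearB/=; exact: A0.
Qed.

Lemma weak_ergodic_cvg u v : weak_right_ergodic S A ->
  fix_space S u -> clin_rg_sub S v ->
  (A i (u + v) : weak X) @[i --> tails A] --> (u : weak X).
Proof.
move=> [cA A0] Su Sv; have [M M0 AM] := cco_bounded S.
apply/weak_cvgP => f.
under eq_fun do rewrite linearD/= (cco_fix Su (cA _)) linearD/=.
suff Av0 : f (A i v) @[i --> tails A] --> (0 : K^o).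
  by have := cvgD (@cvg_cst _ (f u) _ (tails A) _) Av0; rewrite addr0; apply.
have [N N0 fN] := bop_norm_le f.
apply: (clin_cvg0 (B := fun i => bop_comp f (A i)) (M := N * M)) Sv.
- move=> i x; apply: le_trans (fN _) _.
  by rewrite -mulrA ler_wpM2l// AM.
- by rewrite mulr_ge0.
- move=> x g; have /weak_cvgP/(_ f) := A0 x g; rewrite linear0.
  by apply: cvg_trans; apply: near_eq_cvg; apply: filterE => i; rewrite /= !linearB.
Qed.

(** A functional f fixed by the adjoints is constant along A_i x, and by weak
    continuity it takes the same value at the cluster point. *)
Lemma cluster_separates : weak_right_ergodic S A -> weak_cluster_fix S A ->
  fix_separates S.
Proof.
move=> [cA _] Acl f Sf f0.
have [x fx] := bop_neq0 f0.
have [y Sy xy] := Acl x; exists y => // fy.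
have /weak_cvgP/(_ f) : (z : weak X) @[z --> nbhs (y : weak X)] --> (y : weak X).
  exact: cvg_id.
move=> /cvgrPdist_lt/(_ `|f x|); rewrite fy normr_gt0 => /(_ (introN eqP fx)) nfy.
have [|z [/= fz]] := xy [set z | f z = f x] _ _ nfy.
  by apply: (@filterE _ (tails A)) => i; exact: (fix_dual_cco x Sf (cA i)).
by rewrite /= sub0r normrN fz ltxx.
Qed.

Lemma weak_cvg_cluster : weak_cvg_fix S A -> weak_cluster_fix S A.
Proof.
move=> Acv x; have [y Sy Axy] := Acv x; exists y => // B C FB yC.
have FC := Axy _ yC.
have [i Bi] := filter_ex (filterI FB FC); by exists i.
Qed.

Lemma strong_cvg_weak : strong_cvg_fix S A -> weak_cvg_fix S A.
Proof.
by move=> Acv x; have [y Sy /strong_weak_cvg] := Acv x; exists y.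
Qed.

End nets.

End decomposition.

(** * Splitting of the space *)

Section splitting.
Context {K : numFieldType} {G : semitopologicalSemigroupType}.
Context {X : completeNormedModType K} (S : bounded_rep G X).
Context (A : net (bounded_op X X)) (hA : strong_right_ergodic S A).

Definition fix_plus_lin : set X :=
  [set x | exists u v, [/\ fix_space S u, lin (rg_sub S) v & x = u + v]].

Lemma fix_plus_lin_linear a x y :
  fix_plus_lin x -> fix_plus_lin y -> fix_plus_lin (a *: x + y).
Proof.
move=> [u [v [Su Sv ->]]] [u' [v' [Su' Sv' ->]]].
exists (a *: u + u'), (a *: v + v'); split; first exact: fix_space_linear.
  exact: lin_linear.
by rewrite scalerDr addrACA.
Qed.

Lemma fix_plus_lin0 : fix_plus_lin 0.
Proof.
by exists 0, 0; rewrite addr0; split=> //; [exact: fix_space0|exact: lin0].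
Qed.

(** If u + v is close to x, then A_i (u + v) is close to A_i x uniformly in i,
    and converges to u. *)
Lemma fix_plus_lin_net_approx x (e : K) : closure fix_plus_lin x -> 0 < e ->
  exists2 u, fix_space S u & \forall i \near tails A, `|A i x - u| < e.
Proof.
move=> /closure_normP Wx e0; have [M M0 AM] := cco_bounded S.
have M1 : 0 < M + 1 by rewrite ltr_wpDl.
have [w [u [v [Su Sv ->]]] xw] := Wx (e / 2 / (M + 1)) (ltac:(by rewrite !divr_gt0)).
exists u => //.
have /cvgrPdistC_lt/(_ (e / 2)) := strong_ergodic_cvg hA Su (subset_closure Sv).
rewrite divr_gt0// => /(_ isT); apply: filterS => i Aw.
rewrite -(subrK (u + v) x) linearD/= -addrA [ltRHS]splitr.
apply: le_lt_trans (ler_normD _ _) _; rewrite ler_ltD//.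
apply: le_trans (AM _ (hA.1 i) _) _.
apply: (@le_trans _ _ ((M + 1) * `|x - (u + v)|)).
  by rewrite ler_wpM2r// lerDl.
by rewrite -ler_pdivlMl// mulrC ltW.
Qed.

(** This is where completeness enters: by the preceding approximation A_i x is
    a Cauchy net, its limit u is a limit of fixed vectors, and x - u is the limit
    of the x - A_i x, all of which lie in the closed span of the displacements. *)
Lemma closure_fix_plus_lin x : closure fix_plus_lin x ->
  exists u v, [/\ fix_space S u, clin_rg_sub S v & x = u + v].
Proof.
move=> Wx.
have /cauchy_cvg/cvg_ex[u Au] : cauchy (A i x @[i --> tails A]).
  apply: cauchy_exP => e e0; have [u Su Aue] := fix_plus_lin_net_approx Wx e0.
  exists u; apply: filterS Aue => i; rewrite -ball_normE/=.
  by rewrite distrC.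
exists u, (x - u); split; last by rewrite subrKC.
- apply: fix_space_closed; apply/closure_normP => e e0.
  have e20 : 0 < e / 2 by rewrite divr_gt0.
  have [w Sw Aw] := fix_plus_lin_net_approx Wx e20; exists w => //.
  move/cvgrPdist_lt : Au => /(_ _ e20) Au.
  have [i [Aui Awi]] := filter_ex (filterI Au Aw).
  rewrite -(subrK (A i x) u) -addrA [ltRHS]splitr.
  by apply: le_lt_trans (ler_normD _ _) _; rewrite ltrD.
- have xAu : x - A i x @[i --> tails A] --> x - u.
    by apply: cvgB => //; exact: cvg_cst.
  apply: (closed_cvg (clin_rg_sub S) _ _ _ xAu).
  + exact: closed_closure.
  + by apply: filterE => i; exact: clin_displacement (hA.1 i).
Qed.

Lemma fix_space_clin_trivial x : fix_space S x -> clin_rg_sub S x -> x = 0.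
Proof.
move=> Sx Cx.
have Ax : A i x @[i --> tails A] --> x.
  by under eq_fun do rewrite (cco_fix Sx (hA.1 _)); exact: cvg_cst.
have Ax0 := strong_ergodic_cvg hA (fix_space0 S) Cx; rewrite add0r in Ax0.
exact: (cvg_unique (@norm_hausdorff _ X) Ax Ax0).
Qed.

(** If x were outside the closure of fix_plus_lin, a functional would be
    nonzero on the affine space x - fix_plus_lin, hence zero on fix_plus_lin.
    Vanishing on the displacements it is fixed by the adjoints, and vanishing on
    the fixed space it contradicts the separation hypothesis. *)
Lemma separates_direct_sum (hK : real_or_complex K) :
  fix_separates S -> direct_sum (fix_space S) (clin_rg_sub S).
Proof.
move=> sep; split; last first.
  apply/seteqP; split=> [x [Sx Cx]|x ->] /=; first exact: fix_space_clin_trivial.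
  by split; [exact: fix_space0|exact: clin0].
move=> x; apply: closure_fix_plus_lin; apply: contrapT => nWx.
have [d d0 dW] : exists2 d : K, 0 < d & forall w, fix_plus_lin w -> d <= `|x - w|.
  apply: contrapT => nd; apply: nWx; apply/closure_normP => e e0.
  apply: contrapT => ne; apply: nd; exists e => // w Ww.
  rewrite real_leNgt ?(gtr0_real e0) ?normr_real//; apply/negP => xw.
  by apply: ne; exists w.
pose C := [set x - w | w in fix_plus_lin].
have Cconv : convex_stable C.
  move=> _ _ s t [w Ww <-] [z Wz <-] s0 t0 st; exists (s *: w + t *: z).
    exact: (subspace_convex fix_plus_lin0 fix_plus_lin_linear).
  by rewrite !scalerBr addrACA -scalerDl st scale1r opprD.
have Cd c : C c -> d <= `|c| by move=> [w Ww <-]; exact: dW.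
have Cx : C x by exists 0; rewrite ?subr0//; exact: fix_plus_lin0.
have [f [flin fN fdisc]] := separation hK (@ler_normD _ X) (@normrZ _ X)
  (@normr_ge0 _ X) Cconv Cx (ltW d0) Cd.
have fb y : `|f y| <= 1 * `|y| by rewrite mul1r.
pose F : dual X := mk_bounded_op flin fb.
have FC c : C c -> F c <> 0.
  move=> Cc Fc0; have := fdisc c 1 Cc ler01.
  rewrite -[f c]/(F c) Fc0 subr0 normr0 expr0n/= addr0 normr1 expr1n mulr1.
  by rewrite lerBrDr gerDl lt_geF// mulr_gt0.
have FW w : fix_plus_lin w -> F w = 0.
  move=> Ww; apply: contrapT => /eqP Fw0.
  (* a point of x - fix_plus_lin at which F vanishes *)
  apply: (FC (x - (F x / F w) *: w)).
    exists ((F x / F w) *: w) => //; rewrite -[_ *: _]addr0.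
    exact: (fix_plus_lin_linear _ Ww fix_plus_lin0).
  by rewrite linearB linearZ/= /GRing.scale/= divfK// subrr.
have [||u Su] := sep F.
- apply/fix_dualP => g y; apply/eqP; rewrite eq_sym -subr_eq0 -linearB; apply/eqP/FW.
  exists 0, (y - S g y); rewrite add0r; split=> //; first exact: fix_space0.
  by apply: lin_sub; exists y, g.
- by move=> F0; apply: (FC x Cx); rewrite F0.
- by apply; apply: FW; exists u, 0; rewrite addr0; split=> //; exact: lin0.
Qed.

(** The projection is the pointwise limit of the net, and inherits from the net
    linearity, the bound and membership in the closed convex hull. *)
Lemma ergodic_projection : direct_sum (fix_space S) (clin_rg_sub S) ->
  exists P : bounded_op X X, [/\ cco S P,
    forall x, fix_space S (P x) & forall x, clin_rg_sub S (x - P x)].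
Proof.
move=> [dec _].
have exP x : exists u, fix_space S u /\ clin_rg_sub S (x - u).
  by have [u [v [Su Sv ->]]] := dec x; exists u; rewrite addrC addKr.
have [P PP] := choice exP.
have AP x : A i x @[i --> tails A] --> P x.
  by have := strong_ergodic_cvg hA (PP x).1 (PP x).2; rewrite subrKC.
have [M M0 AM] := cco_bounded S.
have Plin : linear P.
  move=> a x y.
  have AaP : A i (a *: x + y) @[i --> tails A] --> a *: P x + P y.
    under eq_fun do rewrite linearP/=.
    by apply: cvgD; [apply: cvgZl_tmp|]; exact: AP.
  exact: (cvg_unique (@norm_hausdorff _ X) (AP _) AaP).
have Pb x : `|P x| <= M * `|x|.
  apply: (closed_cvg (fun y => `|y| <= M * `|x|) _ _ _ (AP x)).
    by apply: closed_norm_le; rewrite mulr_ge0.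
  by apply: filterE => i; exact: AM (hA.1 i) _.
exists (mk_bounded_op Plin Pb); split=> [|x|x]; [|exact: (PP x).1|exact: (PP x).2].
have sAP : A i @[i --> tails A] --> mk_bounded_op Plin Pb by apply/sot_cvgP.
apply: (closed_cvg (cco S) _ _ _ sAP); first exact: cco_closed.
by apply: filterE => i; exact: hA.1.
Qed.

End splitting.

Section projections.
Context {K : numFieldType} {G : semitopologicalSemigroupType}.
Context {X : normedModType K} (S : bounded_rep G X) (P : bounded_op X X).
Context (cP : cco S P) (SP : forall x, fix_space S (P x)).
Context (CP : forall x, clin_rg_sub S (x - P x)).
Context (triv : fix_space S `&` clin_rg_sub S = [set 0]).

Lemma projection_unique u v : fix_space S u -> clin_rg_sub S v -> P (u + v) = u.
Proof.
move=> Su Sv; apply/eqP; rewrite -subr_eq0.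
suff : (fix_space S `&` clin_rg_sub S) (P (u + v) - u) by rewrite triv => /= ->.
split; first apply: (@subspaceB _ _ (fix_space S) _ _ (@fix_space_linear _ _ _ S)) => //.
have -> : P (u + v) - u = v - (u + v - P (u + v)).
  by rewrite opprB addrCA opprD [v + _]addrC addrNK.
apply: (@subspaceB _ _ (clin_rg_sub S) _ _ (@clin_linear _ _ _ S)) => //.
Qed.

(** The vector T x - P x is the difference of x - P x and x - T x, both in the
    closed span of the displacements, so P maps T x to P x. *)
Lemma projection_zero : mean_ergodic_projection S P.
Proof.
split=> // T cT; split; apply: val_inj; apply/funext => x.
  rewrite -[LHS]/(P (T x)) -{1}(subrKC (P x) (T x)) projection_unique//.
  have -> : T x - P x = (x - P x) - (x - T x) by rewrite opprB [RHS]addrC addrA subrK.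
  apply: (@subspaceB _ _ (clin_rg_sub S) _ _ (@clin_linear _ _ _ S)) => //.
  exact: clin_displacement.
exact: cco_fix (SP x) cT.
Qed.

Lemma projection_along : projection_onto_along P (fix_space S) (clin_rg_sub S).
Proof.
have Pfix u : fix_space S u -> P u = u.
  by move=> Su; rewrite -{1}(addr0 u) projection_unique//; exact: clin0.
split.
- by apply: val_inj; apply/funext => x; exact: Pfix.
- apply/seteqP; split=> [_ [x _ <-]//|u Su]; by exists u; rewrite ?Pfix.
- apply/seteqP; split=> [x /= Px|v Sv /=]; first by rewrite -[x]subr0 -Px; exact: CP.
  by rewrite -(add0r v) projection_unique//; exact: fix_space0.
Qed.

End projections.

(** * The equivalences *)

Section cycle.
Context {K : numFieldType} {G : semitopologicalSemigroupType}.
Context {X : normedModType K} (S : bounded_rep G X).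

Lemma mean_ergodic_orbit_fix : mean_ergodic S ->
  forall x, (cco_orbit S x `&` fix_space S) !=set0.
Proof.
move=> [P [cP zP]] x; exists (P x); split; first exact: cco_orbit_eval.
move=> g; have cS : cco S (S g) by apply: hull_cco; apply: sub_convex_hull; exists g.
by rewrite -[RHS](congr1 (fun T : bounded_op X X => T x) (zP _ cS).2).
Qed.

(** A functional fixed by the adjoints is constant on the closed convex hull of
    each orbit; take the orbit of a point where it does not vanish. *)
Lemma orbit_fix_separates :
  (forall x, (cco_orbit S x `&` fix_space S) !=set0) -> fix_separates S.
Proof.
move=> orbfix f Sf f0.
have [x fx] := bop_neq0 f0.
have [y [xy Sy]] := orbfix x; exists y => //.
suff -> : f y = f x by [].
apply: (closed_eq_level (f := f)); apply: closure_subset xy.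
apply: convex_hull_min; last exact: convex_eq_level.
by move=> _ [g _ <-] /=; move/fix_dualP : Sf; apply.
Qed.

Lemma direct_sum_weak_cvg A : direct_sum (fix_space S) (clin_rg_sub S) ->
  weak_right_ergodic S A -> weak_cvg_fix S A.
Proof.
move=> [dec _] hA x; have [u [v [Su Sv ->]]] := dec x.
by exists u => //; exact: (weak_ergodic_cvg hA Su Sv).
Qed.

Lemma direct_sum_strong_cvg A : direct_sum (fix_space S) (clin_rg_sub S) ->
  strong_right_ergodic S A -> strong_cvg_fix S A.
Proof.
move=> [dec _] hA x; have [u [v [Su Sv ->]]] := dec x.
by exists u => //; exact: (strong_ergodic_cvg hA Su Sv).
Qed.

End cycle.

Theorem theorem1p7 (K : numFieldType) (hK : real_or_complex K)
    (X : completeNormedModType K) (G : semitopologicalSemigroupType)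
    (S : bounded_rep G X) (hS : right_amenable K (rep_semigroup S)) :
  [<-> (* (1) *) mean_ergodic S;
       (* (2) *) forall x, (cco_orbit S x `&` fix_space S) !=set0;
       (* (3) *) fix_separates S;
       (* (4) *) direct_sum (fix_space S) (clin_rg_sub S);
       (* (5) *) exists A, weak_right_ergodic S A /\ weak_cluster_fix S A;
                 forall A, weak_right_ergodic S A -> weak_cluster_fix S A;
       (* (6) *) exists A, weak_right_ergodic S A /\ weak_cvg_fix S A;
                 forall A, weak_right_ergodic S A -> weak_cvg_fix S A;
       (* (7) *) exists A, strong_right_ergodic S A /\ weak_cvg_fix S A;
                 forall A, strong_right_ergodic S A -> weak_cvg_fix S A;
       (* (8) *) exists A, strong_right_ergodic S A /\ strong_cvg_fix S A;
                 forall A, strong_right_ergodic S A -> strong_cvg_fix S A]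
  /\
  (mean_ergodic S ->
   exists P : bounded_op X X,
     [/\ mean_ergodic_projection S P,
         projection_onto_along P (fix_space S) (clin_rg_sub S),
         forall A, weak_right_ergodic S A -> wot_cvg A P
       & forall A, strong_right_ergodic S A -> sot_cvg A P]).

Proof.
have [A0 sA0] := exists_strong_right_ergodic hK hS.
have wA0 := strong_weak_right_ergodic sA0.
have sep_sum := separates_direct_sum sA0 hK.
have cluster_sum A : weak_right_ergodic S A -> weak_cluster_fix S A ->
    direct_sum (fix_space S) (clin_rg_sub S).
  by move=> wA Acl; apply: sep_sum; exact: cluster_separates wA Acl.
have weak_sum A : weak_right_ergodic S A -> weak_cvg_fix S A ->
    direct_sum (fix_space S) (clin_rg_sub S).
  by move=> wA Acv; apply: (cluster_sum A wA); exact: weak_cvg_cluster.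
have strong_sum A : strong_right_ergodic S A -> weak_cvg_fix S A ->
    direct_sum (fix_space S) (clin_rg_sub S).
  by move=> sA Acv; apply: (weak_sum A) => //; exact: strong_weak_right_ergodic.
have sum_P : direct_sum (fix_space S) (clin_rg_sub S) ->
    exists P, mean_ergodic_projection S P /\
      projection_onto_along P (fix_space S) (clin_rg_sub S).
  move=> dec; have [P [cP SP CP]] := ergodic_projection sA0 dec.
  exists P; split; first exact: projection_zero cP SP CP dec.2.
  exact: projection_along SP CP dec.2.
split; last first.
  move=> /mean_ergodic_orbit_fix/orbit_fix_separates/sep_sum dec.
  have [P [zP [PP rP kP]]] := sum_P dec.
  have Pdec x : fix_space S (P x) /\ clin_rg_sub S (x - P x).
    split; first by rewrite -rP; exists x.
    rewrite -kP /= linearB/=.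
    have PPx : P (P x) = P x := congr1 (fun T : bounded_op X X => T x) PP.
    by rewrite PPx subrr.
  exists P; split=> // A hA.
    apply/wot_cvgP => x; have [Su Sv] := Pdec x.
    by have := weak_ergodic_cvg hA Su Sv; rewrite subrKC.
  apply/sot_cvgP => x; have [Su Sv] := Pdec x.
  by have := strong_ergodic_cvg hA Su Sv; rewrite subrKC.
tfae.
- exact: mean_ergodic_orbit_fix.
- exact: orbit_fix_separates.
- exact: sep_sum.
- move=> dec; exists A0; split=> //; apply: weak_cvg_cluster.
  exact: direct_sum_weak_cvg.
- move=> [A [wA /(cluster_sum A wA) dec]] B wB; apply: weak_cvg_cluster.
  exact: direct_sum_weak_cvg.
- move=> Acl; exists A0; split=> //; apply: direct_sum_weak_cvg => //.
  exact: cluster_sum wA0 (Acl _ wA0).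
- move=> [A [wA /(weak_sum A wA) dec]] B wB; exact: direct_sum_weak_cvg.
- move=> Acv; exists A0; split=> //; exact: Acv.
- move=> [A [sA /(strong_sum A sA) dec]] B sB.
  by apply: strong_cvg_weak; exact: direct_sum_strong_cvg.
- move=> Acv; exists A0; split=> //; apply: direct_sum_strong_cvg => //.
  exact: strong_sum sA0 (Acv _ sA0).
- move=> [A [sA /strong_cvg_weak/(strong_sum A sA) dec]] B sB.
  exact: direct_sum_strong_cvg.
- move=> Acv; have [|P [zP _]] := sum_P; last by exists P.
  by apply: (strong_sum A0 sA0); apply: strong_cvg_weak; exact: (Acv A0 sA0).
Qed.
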